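(* Let $(G,[\ ])$ be a ternary group, let $a\in G$, and let $V$ be a vector space over a field $\mathbb{K}$. Then there is a one-to-one correspondence between left representations of $(G,[\ ])$ in $V$ and representations in $V$ of the binary group $\mathrm{ret}_a(G,[\ ])$.
   Context: A ternary semigroup $(G,[\ ])$ is a non-empty set $G$ with a map $[\ ]:G\times G\times G\to G$ such that $[[xyz]uv]=[x[yzu]v]=[xy[zuv]]$ for all $x,y,z,u,v\in G$. It is a ternary group if for all $a,b,c\in G$ there are $x,y,z\in G$ with $[xab]=[ayb]=[abz]=c$ (such $x,y,z$ are then unique). In a ternary group the skew element $\overline{x}$ of $x$ is the unique solution $z$ of $[xxz]=x$. For $a\in G$, the retract $\mathrm{ret}_a(G,[\ ])$ is the set $G$ with the binary operation $x\circledast y=[xay]$; for a ternary group it is a group with identity element $\overline{a}$. A left representation of a ternary group $(G,[\ ])$ in $V$ is a map $\Pi^L:G\times G\to\operatorname{End}V$ (linear endomorphisms of $V$) such that $\Pi^L(x_1,x_2)\circ\Pi^L(x_3,x_4)=\Pi^L([x_1x_2x_3],x_4)$ for all $x_1,x_2,x_3,x_4\in G$ and $\Pi^L(x,\overline{x})=\mathrm{id}_V$ for all $x\in G$. A representation of a binary group in $V$ is a group homomorphism into $GL(V)$. *)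

(* Defs.v *)
From HB Require Import structures.
From mathcomp Require Import all_boot all_order all_algebra.
From mathcomp Require Import boolp.

Set Implicit Arguments.
Unset Strict Implicit.
Unset Printing Implicit Defensive.

Import GRing.Theory.

HB.mixin Record isTernarySemigroup G of Choice G := {
  tmul : G -> G -> G -> G;
  tsg_inhabited : inhabited G;
  tmulAl : forall x y z u v : G,
    tmul (tmul x y z) u v = tmul x (tmul y z u) v;
  tmulAr : forall x y z u v : G,
    tmul x (tmul y z u) v = tmul x y (tmul z u v)
}.

#[short(type="ternarySemigroupType")]
HB.structure Definition TernarySemigroup := {G of isTernarySemigroup G & Choice G}.

HB.mixin Record TernarySemigroup_isTernaryGroup G of TernarySemigroup G := {
  tsolvel : forall a b c : G, exists x, tmul x a b = c;
  tsolvem : forall a b c : G, exists y, tmul a y b = c;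
  tsolver : forall a b c : G, exists z, tmul a b z = c
}.

#[short(type="ternaryGroupType")]
HB.structure Definition TernaryGroup :=
  {G of TernarySemigroup_isTernaryGroup G & TernarySemigroup G}.

Section Skew.
Variable G : ternaryGroupType.
Implicit Types x y z : G.

Lemma skew_ex x : exists z : G, tmul x x z == x.
Proof. by have [z /eqP] := tsolver x x x; exists z. Qed.

(* The choice made by [xchoose] is immaterial: see [skew_uniq]. *)
Definition skew_elt x : G := xchoose (skew_ex x).

Lemma skewP x : tmul x x (skew_elt x) = x.
Proof. exact/eqP/(xchooseP (skew_ex x)). Qed.

Lemma tmulKr x y : tmul y x (skew_elt x) = y.
Proof.
have [z <-] := tsolvel x x y.
by rewrite tmulAl tmulAr skewP.
Qed.

Lemma skewKl x y : tmul (skew_elt x) x y = y.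
Proof.
have [w wP] := tsolvel x x x.
have wK t : tmul w x t = t.
  by have [z <-] := tsolver x x t; rewrite -tmulAr -tmulAl wP.
by rewrite -(wK (skew_elt x)) tmulKr wK.
Qed.

Lemma tmulKl x y : tmul x (skew_elt x) y = y.
Proof.
by have [z <-] := tsolver x x y; rewrite -tmulAr skewKl.
Qed.

Lemma skewKr x y : tmul y (skew_elt x) x = y.
Proof.
have [z <-] := tsolvel x x y.
by rewrite tmulAl tmulKr.
Qed.

Lemma skew_uniq x z : tmul x x z = x -> z = skew_elt x.
Proof.
suff zE t : tmul x x t = x -> t = tmul (skew_elt x) (skew_elt x) x.
  by move=> /zE ->; rewrite [RHS](zE _ (skewP x)).
by move=> {3}<-; rewrite -tmulAr !skewKl.
Qed.

End Skew.

Definition retract (G : ternaryGroupType) (a : G) : Type := G.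

Section Retract.
Variables (G : ternaryGroupType) (a : G).
Local Notation R := (retract a).

Definition ret_mul (x y : R) : R := tmul (x : G) a y.
Definition ret_one : R := skew_elt a.
Definition ret_inv (x : R) : R := tmul (skew_elt a) (skew_elt (x : G)) (skew_elt a).

Lemma ret_mulA : associative ret_mul.
Proof. by move=> x y z; rewrite /ret_mul tmulAl tmulAr. Qed.

Lemma ret_mul1 : left_id ret_one ret_mul.
Proof. by move=> x; exact: skewKl. Qed.

Lemma ret_mulr1 : right_id ret_one ret_mul.
Proof. by move=> x; exact: tmulKr. Qed.

Lemma ret_mulV : left_inverse ret_one ret_inv ret_mul.
Proof. by move=> x; rewrite /ret_mul /ret_inv tmulAl tmulAr skewKl skewKr. Qed.

Lemma ret_mulrV : right_inverse ret_one ret_inv ret_mul.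
Proof. by move=> x; rewrite /ret_mul /ret_inv -tmulAr -tmulAl tmulKr tmulKl. Qed.

HB.instance Definition _ := Choice.on R.
HB.instance Definition _ :=
  isGroup.Build R ret_mulA ret_mul1 ret_mulr1 ret_mulV ret_mulrV.

End Retract.

Record GL (K : fieldType) (V : lmodType K) := MkGL {
  gl_lin :> {linear V -> V};
  gl_bij : bijective gl_lin
}.

Section GLGroup.
Variables (K : fieldType) (V : lmodType K).
Local Notation GL := (GL V).

Lemma linear_ext (f g : {linear V -> V}) : f =1 g -> f = g.
Proof.
case: f g => f [[fa] [fb]] [g [[ga] [gb]]] /= /funext fg; subst g.
by congr GRing.Linear.Pack; congr GRing.Linear.Class;
  [congr Algebra.isNmodMorphism.Axioms_|congr GRing.isScalable.Axioms_];
  exact: Prop_irrelevance.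
Qed.

Lemma gl_ext (f g : GL) : f =1 g -> f = g.
Proof.
case: f g => f fb [g gb] /= /linear_ext fg; subst g.
by congr MkGL; exact: Prop_irrelevance.
Qed.

HB.instance Definition _ := gen_eqMixin GL.
HB.instance Definition _ := gen_choiceMixin GL.

Definition gl_mul (f g : GL) : GL :=
  MkGL (bij_comp (gl_bij f) (gl_bij g) : bijective (f \o g : {linear V -> V})).

Definition gl_one : GL :=
  MkGL (inv_bij (fun=> erefl) : bijective (idfun : {linear V -> V})).

Lemma gl_preim (f : GL) (y : V) : exists x, f x == y.
Proof. by have [h _ fK] := gl_bij f; exists (h y); rewrite fK. Qed.

Definition gl_inv_fun (f : GL) (y : V) : V := xchoose (gl_preim f y).

Lemma gl_inv_funK (f : GL) : cancel (gl_inv_fun f) f.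
Proof. by move=> y; exact/eqP/(xchooseP (gl_preim f y)). Qed.

Lemma gl_funK (f : GL) : cancel f (gl_inv_fun f).
Proof. by move=> x; apply: (bij_inj (gl_bij f)); rewrite gl_inv_funK. Qed.

Lemma gl_inv_linear (f : GL) : linear (gl_inv_fun f).
Proof. exact: can2_linear (gl_funK f) (gl_inv_funK f). Qed.

HB.instance Definition _ (f : GL) :=
  GRing.isLinear.Build K V V *:%R (gl_inv_fun f) (@gl_inv_linear f).

Definition gl_inv (f : GL) : GL :=
  MkGL (Bijective (gl_inv_funK f) (gl_funK f) :
    bijective (gl_inv_fun f : {linear V -> V})).

Lemma gl_mulA : associative gl_mul.
Proof. by move=> f g h; exact: gl_ext. Qed.

Lemma gl_mul1 : left_id gl_one gl_mul.
Proof. by move=> f; exact: gl_ext. Qed.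

Lemma gl_mulr1 : right_id gl_one gl_mul.
Proof. by move=> f; exact: gl_ext. Qed.

Lemma gl_mulV : left_inverse gl_one gl_inv gl_mul.
Proof. by move=> f; apply: gl_ext => x; exact: gl_funK. Qed.

Lemma gl_mulrV : right_inverse gl_one gl_inv gl_mul.
Proof. by move=> f; apply: gl_ext => x; exact: gl_inv_funK. Qed.

HB.instance Definition _ :=
  isGroup.Build GL gl_mulA gl_mul1 gl_mulr1 gl_mulV gl_mulrV.

End GLGroup.

Definition group_rep (H : groupType) (K : fieldType) (V : lmodType K) :=
  {multiplicative H -> GL V}.

Record left_rep (G : ternaryGroupType) (K : fieldType) (V : lmodType K) :=
  LeftRep {
    lrep :> G -> G -> {linear V -> V};
    lrepM : forall x1 x2 x3 x4 : G,
      lrep x1 x2 \o lrep x3 x4 =1 lrep (tmul x1 x2 x3) x4;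
    lrep_skew : forall x : G, lrep x (skew_elt x) =1 idfun
  }.

(* Main.v *)
(* The binary representation attached to P is x |-> P x a, whose inverse
   correspondence sends f to (x, y) |-> f [x y skew(a)], because
   P x y = P x y \o P (skew a) a = P [x y skew(a)] a. *)
Require Import Defs.
From HB Require Import structures.
From mathcomp Require Import all_boot all_order all_algebra.
From mathcomp Require Import boolp.

(** A left representation is determined by its maps [P x a], because [P (skew_elt a) a] is the
    identity ([lrep_skewl]). These maps compose along the retract product, [P x a \o P y a = P
    [x a y] a], so each is invertible. Conversely, a representation of the retract extends to pairs
    because [a] and [skew_elt a] cancel in products of elements [[x y skew(a)]]
    ([ternary_rep_funM]). *)

Lemma left_rep_ext (G : ternaryGroupType) (K : fieldType) (V : lmodType K)
    (P Q : left_rep G V) :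
  (forall x y, P x y =1 Q x y) -> P = Q.
Proof.
case: P Q => p pM p1 [q qM q1] /= pq.
have {}pq : p = q by do 2!apply/funext => ?; exact/linear_ext/pq.
by subst q; congr LeftRep; exact: Prop_irrelevance.
Qed.

Lemma group_rep_ext (H : groupType) (K : fieldType) (V : lmodType K)
    (f g : group_rep H V) :
  (forall x, f x =1 g x) -> f = g.
Proof.
move=> fg.
have {}fg : f = g :> (H -> GL V) by apply/funext => x; exact/gl_ext/fg.
case: f g fg => f [[fM]] [g [[gM]]] /= fg; subst g.
by rewrite (Prop_irrelevance fM gM).
Qed.

Lemma gmulf_group1 (H H' : groupType) (f : {multiplicative H -> H'}) :
  f 1%g = 1%g.
Proof. by apply: (mulgI (f 1%g)); rewrite -gmulfM !mulg1. Qed.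

Section Correspondence.
Variables (G : ternaryGroupType) (a : G) (K : fieldType) (V : lmodType K).

Section RestrictLeftRep.
Variable P : left_rep G V.

(** The axiom gives only [P x (skew_elt x) = id]. Composing on the left with [P (skew_elt x) x]
    gives [P [skew(x) x x] (skew_elt x)], which is [P x (skew_elt x)] again. *)
Lemma lrep_skewl (x : G) : P (skew_elt x) x =1 idfun.
Proof.
move=> v; have := lrepM P (skew_elt x) x x (skew_elt x) v.
by rewrite skewKl /= !lrep_skew.
Qed.

Lemma lrep_retract_inv (x : retract a) :
  cancel (P x a) (P (ret_inv x) a).
Proof.
by move=> v; rewrite -[LHS]/((_ \o _) v) lrepM [tmul _ _ _]ret_mulV lrep_skewl.
Qed.

Lemma lrep_retract_invr (x : retract a) :
  cancel (P (ret_inv x) a) (P x a).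
Proof.
by move=> v; rewrite -[LHS]/((_ \o _) v) lrepM [tmul _ _ _]ret_mulrV lrep_skewl.
Qed.

Definition retract_rep_fun (x : retract a) : GL V :=
  MkGL (Bijective (lrep_retract_inv x) (lrep_retract_invr x)).

Lemma retract_rep_funM : {morph retract_rep_fun : x y / (x * y)%g}.
Proof. by move=> x y; apply: gl_ext => v; rewrite /= -[RHS]/((_ \o _) v) lrepM. Qed.

HB.instance Definition _ :=
  isMultiplicative.Build _ _ retract_rep_fun retract_rep_funM.

Definition retract_rep : group_rep (retract a) V := retract_rep_fun.

End RestrictLeftRep.

Section ExtendGroupRep.
Variable f : group_rep (retract a) V.

Definition ternary_rep_fun (x y : G) : {linear V -> V} :=
  f (tmul x y (skew_elt a)).

Lemma ternary_rep_funM (x1 x2 x3 x4 : G) :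
  ternary_rep_fun x1 x2 \o ternary_rep_fun x3 x4
    =1 ternary_rep_fun (tmul x1 x2 x3) x4.
Proof.
move=> v; rewrite /ternary_rep_fun.
have -> : tmul (tmul x1 x2 x3) x4 (skew_elt a) =
    ((tmul x1 x2 (skew_elt a) : retract a)
       * (tmul x3 x4 (skew_elt a) : retract a))%g.
  (* Reassociating isolates [[skew(a) a x3] = x3]. *)
  by rewrite -[RHS]/(tmul _ a _) [RHS]tmulAl [RHS]tmulAr skewKl tmulAl tmulAr.
by rewrite gmulfM.
Qed.

Lemma ternary_rep_fun_skew (x : G) :
  ternary_rep_fun x (skew_elt x) =1 idfun.
Proof.
(* [[x skew(x) skew(a)]] is [skew_elt a], the unit of the retract. *)
move=> v; rewrite /ternary_rep_fun tmulKl.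
by rewrite -[skew_elt a]/(1%g : retract a) gmulf_group1.
Qed.

Definition ternary_rep : left_rep G V :=
  LeftRep ternary_rep_funM ternary_rep_fun_skew.

End ExtendGroupRep.

Lemma retract_repK : cancel retract_rep ternary_rep.
Proof.
move=> P; apply: left_rep_ext => x y v /=.
(* [P [x y skew(a)] a] splits as [P x y \o P (skew_elt a) a]. *)
by rewrite -[LHS]/(P _ a v) -lrepM /= lrep_skewl.
Qed.

Lemma ternary_repK : cancel ternary_rep retract_rep.
Proof.
move=> f; apply: group_rep_ext => x v /=.
(* Setting the second argument to [a] gives [[x a skew(a)] = x]. *)
by rewrite -[LHS]/(f (tmul _ _ _) v) tmulKr.
Qed.

End Correspondence.

Theorem theorem32 (G : ternaryGroupType) (a : G)
    (K : fieldType) (V : lmodType K) :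
  exists F : left_rep G V -> group_rep (retract a) V,
    bijective F /\
    (forall (P : left_rep G V) (x : G), F P x =1 P x a).
Proof.
exists (@retract_rep G a K V); split=> //.
exact: Bijective (@retract_repK G a K V) (@ternary_repK G a K V).
Qed.
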